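(* There is a deterministic algorithm that, given any point set $P$ of size $n$ in general position and any distance function $d$ on $P$, constructs a navigable graph on $P$ with at most $2n^{3/2}-n$ edges in $O(n^2)$ time.
   Context: A distance function on $P$ is any $d:P\times P\to\mathbb{R}_{\ge0}$ with $d(p,p)=0$ and $d(p,q)=d(q,p)>0$ for $p\ne q$ (no triangle inequality assumed), evaluable in $O(1)$ time. General position: points are distinct and $d(p_i,p_j)\neq d(p_i,p_k)$ for all $i$ and $j\ne k$. A directed graph $G=(P,E)$ is navigable if for all $p_i\ne p_j$ there is $p_k$ with $(p_i,p_k)\in E$ and $d(p_k,p_j)<d(p_i,p_j)$. *)

(* Defs.v *)
From mathcomp Require Import all_boot all_order all_algebra.
From mathcomp Require Import reals exp.

Set Implicit Arguments.
Unset Strict Implicit.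
Unset Printing Implicit Defensive.

Import Order.TTheory GRing.Theory Num.Theory.
Local Open Scope ring_scope.

Section Navigability.
Variables (R : realType) (P : finType).

Definition is_distance (d : P -> P -> R) : Prop :=
  [/\ forall x y, 0 <= d x y,
      forall x, d x x = 0,
      forall x y, d x y = d y x
    & forall x y, x <> y -> 0 < d x y].

Definition general_position (n : nat) (p : 'I_n -> P) (d : P -> P -> R) : Prop :=
  injective p /\
  forall i j k : 'I_n, j <> k -> d (p i) (p j) <> d (p i) (p k).

Definition navigable (d : P -> P -> R) (E : {set P * P}) : Prop :=
  forall x y : P, x <> y -> exists z : P, (x, z) \in E /\ d z y < d x y.

End Navigability.

(* Model of computation: a unit-cost word RAM with a distance oracle, presented
   as a structured language.  Words are naturals below a bound [W], so a word
   has log2 W bits.  Registers are named by the program text; memory is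
   addressed indirectly, by the contents of registers.  Distances live in
   registers and memory cells of their own: they can be queried, moved and
   compared, but there is no arithmetic on them and no conversion to words. *)

Inductive binop := Add | Sub | Mul | Div | Mod.

(* [x], [y], [z] name word registers and [u], [v] distance registers. *)
Inductive instr :=
| Nop
| Const  (x c : nat)               (* x := c *)
| Op     (o : binop) (x y z : nat) (* x := y o z *)
| Read   (x y : nat)               (* x := mem[y] *)
| Write  (x y : nat)               (* mem[x] := y *)
| Dist   (u x y : nat)             (* u := d(p_x, p_y) *)
| DRead  (u x : nat)               (* u := dmem[x] *)
| DWrite (x u : nat)               (* dmem[x] := u *)
| Emit   (x y : nat).              (* output the edge (p_x, p_y) *)

Inductive test :=
| Lt  (x y : nat)
| DLt (u v : nat).

Inductive cmd :=
| Do    (i : instr)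
| Seq   (c1 c2 : cmd)
| If    (b : test) (c1 c2 : cmd)
| While (b : test) (c : cmd).

(* Total: subtraction truncates, y / 0 = 0 and y mod 0 = y. *)
Definition eval_op (o : binop) (y z : nat) : nat :=
  match o with
  | Add => (y + z)%N
  | Sub => (y - z)%N
  | Mul => (y * z)%N
  | Div => (y %/ z)%N
  | Mod => (y %% z)%N
  end.

Section Semantics.
Variables (R : realType) (n : nat).

Record state := State {
  reg  : nat -> nat;
  mem  : nat -> nat;
  dreg : nat -> R;
  dmem : nat -> R;
  out  : seq ('I_n * 'I_n)
}.

(* The input size is in register 0; everything else is zero. *)
Definition init : state :=
  State [eta fun=> 0%N with 0%N |-> n] (fun=> 0%N) (fun=> 0) (fun=> 0) [::].

Definition set_reg (s : state) (x v : nat) : state :=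
  State [eta reg s with x |-> v] (mem s) (dreg s) (dmem s) (out s).
Definition set_mem (s : state) (a v : nat) : state :=
  State (reg s) [eta mem s with a |-> v] (dreg s) (dmem s) (out s).
Definition set_dreg (s : state) (u : nat) (r : R) : state :=
  State (reg s) (mem s) [eta dreg s with u |-> r] (dmem s) (out s).
Definition set_dmem (s : state) (a : nat) (r : R) : state :=
  State (reg s) (mem s) (dreg s) [eta dmem s with a |-> r] (out s).
Definition add_out (s : state) (e : 'I_n * 'I_n) : state :=
  State (reg s) (mem s) (dreg s) (dmem s) (rcons (out s) e).

Variables (W : nat) (d : 'I_n -> 'I_n -> R).

Definition set_word (s : state) (x v : nat) : option state :=
  if (v < W)%N then Some (set_reg s x v) else None.

(* [None] is a crash: word overflow, or a point index that is not below [n]. *)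
Definition run_instr (i : instr) (s : state) : option state :=
  match i with
  | Nop => Some s
  | Const x c => set_word s x c
  | Op o x y z => set_word s x (eval_op o (reg s y) (reg s z))
  | Read x y => set_word s x (mem s (reg s y))
  | Write x y => Some (set_mem s (reg s x) (reg s y))
  | Dist u x y =>
      if (insub (reg s x), insub (reg s y)) is (Some a, Some b)
      then Some (set_dreg s u (d a b)) else None
  | DRead u x => Some (set_dreg s u (dmem s (reg s x)))
  | DWrite x u => Some (set_dmem s (reg s x) (dreg s u))
  | Emit x y =>
      if (insub (reg s x), insub (reg s y)) is (Some a, Some b)
      then Some (add_out s (a, b)) else None
  end.

Definition run_test (b : test) (s : state) : bool :=
  match b with
  | Lt x y => (reg s x < reg s y)%N
  | DLt u v => dreg s u < dreg s v
  end.

(* [exec c s t s']: started in [s], [c] halts without crashing in [s'] after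
   [t] steps; an instruction or the evaluation of a test is one step. *)
Inductive exec : cmd -> state -> nat -> state -> Prop :=
| exec_do i s s' : run_instr i s = Some s' -> exec (Do i) s 1%N s'
| exec_seq c1 c2 s s1 s' t1 t2 :
    exec c1 s t1 s1 -> exec c2 s1 t2 s' -> exec (Seq c1 c2) s (t1 + t2)%N s'
| exec_if b c1 c2 s s' t :
    exec (if run_test b s then c1 else c2) s t s' ->
    exec (If b c1 c2) s t.+1 s'
| exec_while_done b c s : ~~ run_test b s -> exec (While b c) s 1%N s
| exec_while_step b c s s1 s' t1 t2 :
    run_test b s -> exec c s t1 s1 -> exec (While b c) s1 t2 s' ->
    exec (While b c) s (t1 + t2).+1%N s'.

Lemma exec_deterministic c s t1 s1 t2 s2 :
  exec c s t1 s1 -> exec c s t2 s2 -> t1 = t2 /\ s1 = s2.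
Proof.
move=> e1; elim: e1 t2 s2 => {c s t1 s1}.
- move=> i s s' e t2 s2 e2; inversion e2; subst; split=> //.
  by apply: Some_inj; rewrite -e; assumption.
- move=> c1 c2 s s1 s' t1 t2 _ IH1 _ IH2 t s2 e2; inversion e2; subst.
  match goal with h : exec c1 _ _ _ |- _ => case: (IH1 _ _ h) => *; subst end.
  by match goal with h : exec c2 _ _ _ |- _ => case: (IH2 _ _ h) => *; subst end.
- move=> b c1 c2 s s' t _ IH t2 s2 e2; inversion e2; subst.
  by match goal with h : exec _ _ _ _ |- _ => case: (IH _ _ h) => *; subst end.
- move=> b c s /negPf nb t2 s2 e2; inversion e2; subst => //.
  by congruence.
- move=> b c s s1 s' t1 t2 hb _ IH1 _ IH2 t s2 e2; inversion e2; subst.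
    by match goal with h : is_true (~~ _) |- _ => rewrite hb in h end.
  match goal with h : exec c _ _ _ |- _ => case: (IH1 _ _ h) => *; subst end.
  by match goal with h : exec (While _ _) _ _ _ |- _ =>
    case: (IH2 _ _ h) => *; subst end.
Qed.

End Semantics.

Definition output_graph (R : realType) (P : finType) (n : nat)
    (p : 'I_n -> P) (s : state R n) : {set P * P} :=
  [set (p e.1, p e.2) | e in out s].

(* Main.v *)
(* Split the points into [g = ceil (sqrt n)] residue classes of size at most
   [q = ceil (n / g)].  Make each class a clique and, for every point [j] and
   every class, add an edge to [j] from the point of the class nearest to [j].
   The result is navigable: from [i] towards [j], either [i] is nearest to [j]
   in its class and has an edge to [j], or it steps to the point that is.  The
   nearest point in the class of [j] is [j] itself, so there are at most
   [n * (q - 1) + n * (g - 1)] edges, and [q + g - 1 <= 2 * sqrt n].  Scanning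
   all pairs takes quadratic time; no sorting is needed. *)
Require Import Defs.
From mathcomp Require Import all_boot all_order all_algebra.
From mathcomp Require Import reals exp.
From mathcomp Require Import zify.

Set Implicit Arguments.
Unset Strict Implicit.
Unset Printing Implicit Defensive.

Import Order.TTheory GRing.Theory Num.Theory.
Local Open Scope ring_scope.

(** * Timed Hoare-style rules for the machine *)

Section Runs.
Variables (R : realType) (n W : nat) (d : 'I_n -> 'I_n -> R).
Implicit Types (s : state R n) (Q : state R n -> Prop) (T : nat).

(** A total-correctness triple for one start state: termination without a crash within [T] steps.
    Since [T] is only an upper bound, branches of different cost can share one budget. *)
Definition runs (c : cmd) s T Q :=
  exists t s', [/\ exec W d c s t s', (t <= T)%N & Q s'].

Lemma runs_le c s T T' Q : (T <= T')%N -> runs c s T Q -> runs c s T' Q.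
Proof.
move=> leT [t [s' [e le q]]]; exists t, s'; split=> //; exact: leq_trans le leT.
Qed.

Lemma runs_post c s T Q Q' :
  runs c s T Q -> (forall s', Q s' -> Q' s') -> runs c s T Q'.
Proof. by move=> [t [s' [e le q]]] h; exists t, s'; split=> //; exact: h. Qed.

Lemma runs_do i s s' Q : run_instr W d i s = Some s' -> Q s' -> runs (Do i) s 1 Q.
Proof. by move=> e q; exists 1%N, s'; split=> //; constructor. Qed.

Lemma runs_seq c1 c2 s T1 T2 Q :
  runs c1 s T1 (fun s1 => runs c2 s1 T2 Q) -> runs (Seq c1 c2) s (T1 + T2) Q.
Proof.
move=> [t1 [s1 [e1 l1 [t2 [s2 [e2 l2 q]]]]]]; exists (t1 + t2)%N, s2.
by split=> //; [exact: exec_seq e1 e2 | exact: leq_add].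
Qed.

Lemma runs_do_seq i c s s' T Q :
  run_instr W d i s = Some s' -> runs c s' T Q -> runs (Seq (Do i) c) s T.+1 Q.
Proof. by move=> e r; rewrite -add1n; apply/runs_seq/runs_do/r. Qed.

Lemma runs_if b c1 c2 s T Q :
  runs (if run_test b s then c1 else c2) s T Q -> runs (If b c1 c2) s T.+1 Q.
Proof. by move=> [t [s' [e l q]]]; exists t.+1, s'; split=> //; constructor. Qed.

(** The invariant carries the iteration number [r], so [r < N] plays the part of a termination
    measure. Each round pays [T] for the body and one for the test; the final failing test is the
    extra one. *)
Lemma runs_while (Inv : nat -> state R n -> Prop) b c N T s Q :
  Inv 0%N s ->
  (forall r s, Inv r s -> run_test b s -> (r < N)%N /\ runs c s T (Inv r.+1)) ->
  (forall r s, Inv r s -> ~~ run_test b s -> Q s) ->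
  runs (While b c) s (N * T.+1).+1 Q.
Proof.
move=> inv0 step post.
suff H m r s1 : (N - r <= m)%N -> Inv r s1 ->
    runs (While b c) s1 (m * T.+1).+1 Q.
  by apply: (H N 0%N); rewrite ?subn0.
elim: m r s1 => [|m IH] r s1 hm inv.
  have nb : ~~ run_test b s1 by apply/negP => /(step _ _ inv)[]; lia.
  exists 1%N, s1; split=> //; [exact: exec_while_done | exact: post inv nb].
case: (boolP (run_test b s1)) => [hb|nb]; last first.
  exists 1%N, s1; split=> //; [exact: exec_while_done | exact: post inv nb].
have [ltr [t1 [s2 [e1 l1 inv2]]]] := step _ _ inv hb.
have [|t2 [s3 [e2 l2 q]]] := IH r.+1 s2 _ inv2; first lia.
exists (t1 + t2).+1, s3; split=> //; first exact: exec_while_step hb e1 e2.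
by move: l1 l2; rewrite mulSn; lia.
Qed.

Lemma run_dist s u x y (a b : 'I_n) : reg s x = a -> reg s y = b ->
  run_instr W d (Dist u x y) s = Some (set_dreg s u (d a b)).
Proof. by move=> /= -> ->; rewrite !valK. Qed.

Lemma run_emit s x y (a b : 'I_n) : reg s x = a -> reg s y = b ->
  run_instr W d (Emit x y) s = Some (add_out s (a, b)).
Proof. by move=> /= -> ->; rewrite !valK. Qed.

Lemma set_word_lt s x v : (v < W)%N -> set_word W s x v = Some (set_reg s x v).
Proof. by rewrite /set_word => ->. Qed.

End Runs.

(* Word registers: 0 holds [n], 1 holds [1], 2 the number [g] of classes,
   3 holds [g * g], 4 the target [j], 5 the class, 6 the scanned point,
   7 the nearest point so far, 8 holds [0].  Distance registers: 0 holds [0],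
   1 the smallest distance so far, 2 the current distance. *)
Definition sqrt_up_cmd : cmd :=
  While (Lt 3 0) (Seq (Do (Op Add 2 2 1)) (Do (Op Mul 3 2 2))).

(** The stride [g] keeps register 6 inside the class of the target, and the comparison with the zero
    distance skips the target itself. *)
Definition clique_cmd : cmd :=
  While (Lt 6 0)
    (Seq (Do (Dist 2 6 4))
    (Seq (If (DLt 0 2) (Do (Emit 6 4)) (Do Nop))
         (Do (Op Add 6 6 2)))).

(** Adding register 8, which holds zero, acts as a register copy. *)
Definition nearest_cmd : cmd :=
  While (Lt 6 0)
    (Seq (Do (Dist 2 6 4))
    (Seq (If (DLt 2 1) (Seq (Do (Op Add 7 6 8)) (Do (Dist 1 6 4))) (Do Nop))
         (Do (Op Add 6 6 2)))).

Definition classes_cmd : cmd :=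
  While (Lt 5 2)
    (Seq (Do (Op Add 6 5 8))
    (Seq (Do (Op Add 7 5 8))
    (Seq (Do (Dist 1 5 4))
    (Seq nearest_cmd
    (Seq (If (DLt 0 1) (Do (Emit 7 4)) (Do Nop))
         (Do (Op Add 5 5 1))))))).

Definition targets_cmd : cmd :=
  While (Lt 4 0)
    (Seq (Do (Op Mod 6 4 2))
    (Seq clique_cmd
    (Seq (Do (Const 5 0))
    (Seq classes_cmd
         (Do (Op Add 4 4 1)))))).

Definition navigable_cmd : cmd :=
  Seq (Do (Const 1 1)) (Seq sqrt_up_cmd targets_cmd).

(** * Residue classes and the size of the class graph *)

Lemma ceil_div_bounds (n g : nat) (q := ((n + g.-1) %/ g)%N) :
  (0 < g)%N -> (n <= q * g <= n + g.-1)%N.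
Proof.
move=> g_gt0; rewrite leq_divM andbT.
by have := ltn_ceil (n + g.-1) g_gt0; rewrite -/q mulSn; lia.
Qed.

(** Distinct members of one class are at least [g] apart, so moving a scan from [a] to [a + g] adds
    only [a] to the part of the class already seen. *)
Lemma lt_same_mod (g i a : nat) :
  i = a %[mod g] -> (i < a + g)%N -> i != a -> (i < a)%N.
Proof.
move=> e lti /eqP ia; rewrite ltnNge; apply/negP => lea; apply: ia.
have /dvdnP[m hm] : (g %| i - a)%N by rewrite -eqn_mod_dvd //; exact/eqP.
suff : m = 0%N by lia.
by apply/eqP; rewrite -leqn0 -ltnS; nia.
Qed.

Section Graph.
Variables (R : realType) (n : nat) (d : 'I_n -> 'I_n -> R) (g : nat).

Definition nearest_in_class (i j : 'I_n) : bool :=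
  [forall k : 'I_n, (k == i %[mod g]) ==> (d i j <= d k j)].

Definition class_edge (e : 'I_n * 'I_n) : bool :=
  (e.1 != e.2) && ((e.1 == e.2 %[mod g]) || nearest_in_class e.1 e.2).

Hypothesis d_self : forall i, d i i = 0.
Hypothesis d_gt0 : forall i j : 'I_n, i != j -> 0 < d i j.
Hypothesis d_inj : forall j, injective (d^~ j).

Lemma d_pos i j : (0 < d i j) = (i != j).
Proof. by case: eqVneq => [->|/d_gt0 ->] //; rewrite d_self ltxx. Qed.

Lemma class_edge_navigable i j : i != j ->
  exists k, class_edge (i, k) /\ d k j < d i j.
Proof.
move=> ij.
case: (@arg_minP _ _ _ i (fun k : 'I_n => k == i %[mod g]) (d^~ j)) => //= m mi min.
have [mi'|mi'] := eqVneq m i; last first.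
  exists m; split; first by rewrite /class_edge /= eq_sym mi' eq_sym mi.
  (* Minimality gives only [<=]; equality would force [m = i], as distances to [j] are distinct. *)
  rewrite lt_neqAle min // andbT; apply: contra mi' => /eqP h.
  by apply/eqP; apply: (d_inj (j := j)).
exists j; rewrite d_self d_gt0 //; split=> //; rewrite /class_edge /= ij /=.
apply/orP; right; apply/forallP => k; apply/implyP => ki.
by rewrite -mi' min.
Qed.

Hypothesis g_gt0 : (0 < g)%N.
Variable q : nat.
Hypothesis n_le : (n <= q * g)%N.

(** Within a class the quotient by [g] determines the point, and it is below [q]. *)
Lemma class_size (j : 'I_n) : (#|[pred i : 'I_n | i == j %[mod g]]| <= q)%N.
Proof.
have lt_q (i : 'I_n) : (i %/ g < q)%N.
  by rewrite ltn_divLR //; exact: leq_trans (ltn_ord i) n_le.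
rewrite -[q in leqRHS]card_ord -(@card_in_image _ _ (fun i => Ordinal (lt_q i))).
  exact: max_card.
move=> i k /eqP hi /eqP hk [h]; apply/val_inj.
by rewrite /= (divn_eq i g) (divn_eq k g) h hi hk.
Qed.

(** Taking residues is injective here: two nearest points of one class are equidistant from [j],
    hence equal. The residue of [j] is missed, because in that class [j] itself, at distance zero,
    beats every other point. *)
Lemma nearest_count (j : 'I_n) :
  (#|[pred i : 'I_n | (i != j) && nearest_in_class i j]| < g)%N.
Proof.
have lt_g (i : 'I_n) : (i %% g < g)%N by rewrite ltn_mod.
pose f i := Ordinal (lt_g i).
rewrite -[g in ltnRHS]card_ord -[leqRHS]add0n.
rewrite (cardD1 (f j)) inE add0n add1n ltnS.
rewrite -(@card_in_image _ _ f).
  apply/subset_leq_card/subsetP => _ /imageP[i /andP[ij /forallP h] ->].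
  rewrite !inE andbT; apply/negP => /eqP [e].
  have := h j; rewrite e eqxx /= d_self => /le_lt_trans /(_ (d_gt0 ij)).
  by rewrite ltxx.
move=> i k /andP[_ /forallP hi] /andP[_ /forallP hk] [e].
apply: (d_inj (j := j)); apply/eqP; rewrite eq_le.
by have := hi k; have := hk i; rewrite e eqxx /= => -> ->.
Qed.

(** Edges are counted by target: those into [j] start at one of at most [q.-1] other members of its
    class or at one of at most [g.-1] nearest points. *)
Lemma card_class_edge : (#|class_edge| <= n * (q.-1 + g.-1))%N.
Proof.
rewrite -sum1_card (eq_bigl (fun e => class_edge (e.1, e.2))); last by case.
rewrite -(pair_big_dep xpredT (fun i j => class_edge (i, j)) (fun _ _ => 1%N)) /=.
rewrite (exchange_big_dep xpredT) //=.
rewrite -[n in leqRHS]card_ord -sum_nat_const.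
apply: leq_sum => j _; rewrite sum1_card.
apply: leq_trans (_ : (#|[predD1 [pred i : 'I_n | i == j %[mod g]] & j]| +
  #|[pred i : 'I_n | (i != j) && nearest_in_class i j]|)%N <= _)%N.
  rewrite -cardUI; apply: leq_trans (leq_addr _ _).
  apply/subset_leq_card/subsetP => i; rewrite !inE /class_edge /=.
  by rewrite unfold_in; case: (i != j).
have := class_size j; have := nearest_count j.
rewrite (cardD1 j [pred i : 'I_n | i == j %[mod g]]) inE eqxx.
by move: #|_| #|_|; lia.
Qed.

End Graph.

(** * Correctness and running time of the program *)

Section Correctness.
Variables (R : realType) (n W : nat) (d : 'I_n -> 'I_n -> R).
Hypothesis d_self : forall i, d i i = 0.
Hypothesis d_gt0 : forall i j : 'I_n, i != j -> 0 < d i j.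
Hypothesis W_ge : ((n + 2) ^ 2 <= W)%N.

(** The loop stops at the first [g] whose square reaches [n], so the square of its predecessor is
    still below [n]. The case [g = 0] is the state before the first round, which is final only for
    [n = 0]. *)
Lemma sqrt_up_correct (s : state R n) :
  reg s 0 = n -> reg s 1 = 1%N -> reg s 2 = 0%N -> reg s 3 = 0%N ->
  reg s 4 = 0%N -> reg s 8 = 0%N -> dreg s 0 = 0 -> out s = [::] ->
  runs W d sqrt_up_cmd s (n * 3).+1%N (fun s' => exists g,
    [/\ (n <= g * g)%N, (g = 0)%N \/ (g.-1 * g.-1 < n)%N,
        [/\ reg s' 0 = n, reg s' 1 = 1%N, reg s' 2 = g, reg s' 8 = 0%N &
            dreg s' 0 = 0],
        reg s' 4 = 0%N & out s' = [::]]).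
Proof.
move=> s0 s1 s2 s3 s4 s8 u0 os.
pose Inv g (s' : state R n) : Prop :=
    [/\ reg s' 3 = (g * g)%N, (g = 0)%N \/ (g.-1 * g.-1 < n)%N,
        [/\ reg s' 0 = n, reg s' 1 = 1%N, reg s' 2 = g, reg s' 8 = 0%N &
            dreg s' 0 = 0],
        reg s' 4 = 0%N & out s' = [::]].
apply: (@runs_while _ _ _ _ Inv) => [|r s'|r s']; first by split=> //; left.
- move=> [h3 hr [h0 h1 h2 h8 hu] h4 ho] /=; rewrite h3 h0 => lt.
  split; first nia.
  apply: runs_do_seq; first by rewrite /= h1 h2 set_word_lt //; nia.
  apply: runs_do; first by rewrite /= set_word_lt //=; nia.
  split=> //=; [lia | right; lia | split=> //=; lia].
- move=> [h3 hr h h4 ho] /= lt; case: (h) => h0 *; exists r; split=> //; lia.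
Qed.

(** The bound covers a scan that overshoots [n] by one stride [g <= n]. *)
Lemma small_lt_word v : (v <= n + n + 1)%N -> (v < W)%N.
Proof. by move=> le; apply: leq_trans W_ge; nia. Qed.

Variables (g q : nat).
Hypothesis g_gt0 : (0 < g)%N.
Hypothesis g_le : (g <= n)%N.
Hypothesis n_le : (n <= q * g)%N.

Definition consts (s : state R n) : Prop :=
  [/\ reg s 0 = n, reg s 1 = 1%N, reg s 2 = g, reg s 8 = 0%N & dreg s 0 = 0].

(** Soundness is kept for the whole output, completeness only for the targets below [j]. *)
Definition partial_graph (j : nat) (s : state R n) : Prop :=
  [/\ consts s, reg s 4 = j,
      forall e, e \in out s -> class_edge d g e &
      forall e : 'I_n * 'I_n, class_edge d g e -> (e.2 < j)%N -> e \in out s].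

Lemma clique_correct (j : 'I_n) s :
  partial_graph j s -> reg s 6 = (j %% g)%N ->
  runs W d clique_cmd s (q * 5).+1%N (fun s' => partial_graph j s' /\
    forall i : 'I_n, i == j %[mod g] -> i != j -> (i, j) \in out s').
Proof.
move=> ps s6.
pose Inv r (s' : state R n) : Prop := [/\ partial_graph j s',
    reg s' 6 = (j %% g + r * g)%N &
    forall i : 'I_n, i == j %[mod g] -> i != j -> (i < reg s' 6)%N ->
      (i, j) \in out s'].
apply: (@runs_while _ _ _ _ Inv) => [|r s'|r s'].
- split=> //; first by rewrite s6; lia.
  (* A class member is at least its own residue, so none lies below the start of the scan. *)
  move=> i /eqP ij _; rewrite s6 -ij => h; have := leq_mod i g; lia.
- move=> [[[h0 h1 h2 h8 hu] h4 hs hc] h6 hin] /=; rewrite h0 => lt.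
  (* At most [q] rounds: [r * g <= reg s' 6 < n <= q * g]. *)
  split; first by move: lt; rewrite h6; nia.
  pose a := Ordinal lt.
  have am : (a = j %[mod g])%N by rewrite /= h6 addnC modnMDl modn_mod.
  have nextE (i : 'I_n) : i == j %[mod g] -> (i < reg s' 6 + g)%N -> i != a ->
      (i < reg s' 6)%N.
    by move=> /eqP ij lti ia; apply: (lt_same_mod (g := g)) => //; rewrite am ij.
  apply: runs_do_seq; first by exact: (@run_dist _ _ _ _ _ _ _ _ a j).
  apply: (runs_seq (T1 := 2) (T2 := 1)); apply: runs_if => /=.
  rewrite hu d_pos //; case: ifPn => [aj|aj].
    apply: runs_do; first exact: (@run_emit _ _ _ _ _ _ _ a j).
    apply: runs_do; first by rewrite /= h2 set_word_lt //; apply: small_lt_word; lia.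
    split=> /=; last 1 first.
    - move=> i ij ij' lti; rewrite mem_rcons inE xpair_eqE eqxx andbT.
      by have [//|ia] := eqVneq i a; apply: hin => //; exact: nextE.
    - split=> //= [e|e he hj]; rewrite mem_rcons inE.
        by case/orP => [/eqP->|/hs //]; rewrite /class_edge /= aj h6 addnC modnMDl modn_mod eqxx.
      by rewrite hc ?orbT.
    - by lia.
  apply: runs_do => //.
  apply: runs_do; first by rewrite /= h2 set_word_lt //; apply: small_lt_word; lia.
  split=> //=; first by lia.
  move=> i ij ij' lti; apply: hin => //; apply: nextE => //.
  by move: aj; rewrite negbK => /eqP->.
move=> [ps' _ hin] /= lt; split=> // i ij ij'; apply: hin => //.
by case: ps' => [[h0 _ _ _ _] _ _ _]; move: lt; rewrite h0; have := ltn_ord i; lia.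
Qed.

(** Since [c < g], [c] is both the label of the class and its smallest member, hence a valid first
    candidate. *)
Lemma nearest_correct (j c : 'I_n) s :
  (c < g)%N -> partial_graph j s -> reg s 5 = c -> reg s 6 = c -> reg s 7 = c ->
  dreg s 1 = d c j ->
  runs W d nearest_cmd s (q * 6).+1%N (fun s' => exists b : 'I_n,
    [/\ partial_graph j s', reg s' 5 = c, reg s' 7 = b, dreg s' 1 = d b j &
      out s' = out s /\ (b %% g)%N = c /\ nearest_in_class d g b j]).
Proof.
move=> ltc ps s5 s6 s7 su.
pose Inv r (s' : state R n) : Prop := [/\ partial_graph j s', reg s' 5 = c,
    reg s' 6 = (c + r * g)%N,
    out s' = out s &
    exists b : 'I_n, [/\ reg s' 7 = b, dreg s' 1 = d b j, (b %% g)%N = c &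
    forall i : 'I_n, (i %% g)%N = c -> (i < reg s' 6)%N -> d b j <= d i j]].
apply: (@runs_while _ _ _ _ Inv) => [|r s'|r s'].
- split=> //; first by rewrite s6; lia.
  exists c; split=> //; first by rewrite modn_small.
  by move=> i ic; rewrite s6 -[X in (_ < X)%N]ic => h; have := leq_mod i g; lia.
- move=> [[[h0 h1 h2 h8 hu] h4 hs hc] h5 h6 ho [b [h7 hb bc hmin]]] /=.
  rewrite h0 => lt.
  split; first by move: lt; rewrite h6; nia.
  pose a := Ordinal lt.
  have am : (a %% g)%N = c by rewrite /= h6 addnC modnMDl modn_small.
  have nextE (i : 'I_n) : (i %% g)%N = c -> (i < reg s' 6 + g)%N -> i != a ->
      (i < reg s' 6)%N.
    by move=> ic lti ia; apply: (lt_same_mod (g := g)) => //; rewrite am ic.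
  apply: runs_do_seq; first by exact: (@run_dist _ _ _ _ _ _ _ _ a j).
  apply: (runs_seq (T1 := 3) (T2 := 1)); apply: runs_if => /=.
  case: ifPn => [ab|ab].
    apply: runs_do_seq; first by rewrite /= h8 addn0 set_word_lt //; apply: small_lt_word; lia.
    apply: runs_do; first by exact: (@run_dist _ _ _ _ _ _ _ _ a j).
    apply: runs_do; first by rewrite /= h2 set_word_lt //; apply: small_lt_word; lia.
    split=> //=; first by lia.
    exists a; split=> // i ic lti.
    have [->//|ia] := eqVneq i a; apply: ltW; apply: lt_le_trans (ab) _.
    by rewrite hb; apply: hmin => //; exact: nextE.
  (* The [Nop] branch costs one step less than the budget of the update branch. *)
  apply: (@runs_le _ _ _ _ _ _ 1) => //; apply: runs_do => //.
  apply: runs_do; first by rewrite /= h2 set_word_lt //; apply: small_lt_word; lia.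
  split=> //=; first by lia.
  exists b; split=> // i ic lti.
  have [->|ia] := eqVneq i a; first by rewrite -hb leNgt.
  by apply: hmin => //; exact: nextE.
move=> [ps' h5 _ ho [b [h7 hb bc hmin]]] /= lt.
exists b; split=> //; split=> //; split=> //.
apply/forallP => i; apply/implyP => /eqP ib; apply: hmin; first by rewrite ib.
by case: ps' => [[h0 _ _ _ _] _ _ _]; move: lt; rewrite h0; have := ltn_ord i; lia.
Qed.

Hypothesis d_inj : forall j, injective (d^~ j).

Lemma classes_correct (j : 'I_n) s :
  partial_graph j s -> reg s 5 = 0%N ->
  (forall i : 'I_n, i == j %[mod g] -> i != j -> (i, j) \in out s) ->
  runs W d classes_cmd s (g * (q * 6 + 8)).+1%N (fun s' => partial_graph j s' /\
    forall i : 'I_n, class_edge d g (i, j) -> (i, j) \in out s').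
Proof.
move=> ps s5 hcl.
pose Inv r (s' : state R n) : Prop := [/\ partial_graph j s', reg s' 5 = r,
    forall i : 'I_n, i == j %[mod g] -> i != j -> (i, j) \in out s' &
    forall i : 'I_n, nearest_in_class d g i j -> i != j -> (i %% g < r)%N ->
     (i, j) \in out s'].
(* One of the 8 steps is the loop test. *)
rewrite (addnS _ 7); apply: (@runs_while _ _ _ _ Inv) => [|r s'|r s']; first by split.
- move=> [[[h0 h1 h2 h8 hu] h4 hs hc] h5 hq hn] /=; rewrite h2 h5 => lt; split=> //.
  have ltn := leq_trans lt g_le; pose c := Ordinal ltn.
  rewrite (_ : q * 6 + 7 = ((q * 6).+1 + (2 + 1)).+3)%N; last by lia.
  apply: runs_do_seq; first by rewrite /= h8 h5 addn0 set_word_lt //; apply: small_lt_word; lia.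
  apply: runs_do_seq; first by rewrite /= h8 h5 addn0 set_word_lt //; apply: small_lt_word; lia.
  apply: runs_do_seq; first by exact: (@run_dist _ _ _ _ _ _ _ _ c j).
  apply: runs_seq; apply: runs_post; first by apply: (@nearest_correct j c).
  move=> s1 [b [[[k0 k1 k2 k8 ku] k4 ks kc] k5 k7 kb [/= ko [bc bn]]]].
  apply/runs_seq/runs_if => /=; rewrite ku kb d_pos //; case: ifPn => [bj|bj].
    apply: runs_do; first exact: (@run_emit _ _ _ _ _ _ _ b j).
    apply: runs_do; first by rewrite /= k5 k1 set_word_lt //=; apply: small_lt_word; lia.
    split=> /=; last 1 first.
    - move=> i inear ij; rewrite ltnS leq_eqVlt mem_rcons inE xpair_eqE eqxx andbT.
      case/orP => [/eqP e|lti]; last by rewrite ko hn ?orbT.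
      (* Distinct distances make the nearest point unique, so [i] is the emitted [b]. *)
      apply/orP; left; apply/eqP; apply: (d_inj (j := j)); apply/eqP; rewrite eq_le.
      move/forallP: inear => /(_ b); move/forallP: bn => /(_ i).
      by rewrite bc e eqxx /= => -> ->.
    - split=> //= [e|e he hj]; rewrite mem_rcons inE.
        by case/orP => [/eqP->|/ks //]; rewrite /class_edge /= bj bn orbT.
      by rewrite kc ?orbT.
    - by rewrite addn1.
    - by move=> i ij ij'; rewrite mem_rcons inE ko hq ?orbT.
  (* Here [b = j], so its class has no nearest point other than [j] and nothing is to be emitted. *)
  apply: runs_do => //.
  apply: runs_do; first by rewrite /= k5 k1 set_word_lt //=; apply: small_lt_word; lia.
  split=> //=; rewrite ?k5 ?addn1 ?ko // => i inear ij.
  rewrite ltnS leq_eqVlt => /orP[/eqP e|]; last exact: hn.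
  case/negP: ij; move: bj; rewrite negbK => /eqP <-.
  apply/eqP; apply: (d_inj (j := j)); apply/eqP; rewrite eq_le.
  move/forallP: inear => /(_ b); move/forallP: bn => /(_ i).
  by rewrite bc e eqxx /= => -> ->.
move=> [ps' h5 hq hn] /= lt; split=> // i /andP[/= ij /orP[h|h]].
  exact: hq.
apply: hn => //; case: ps' => [[_ _ h2 _ _] _ _ _]; move: lt; rewrite h2 h5 -leqNgt.
by apply: leq_trans; rewrite ltn_mod.
Qed.

Lemma targets_correct s : partial_graph 0 s ->
  runs W d targets_cmd s (n * (q * 5 + g * (q * 6 + 8) + 6)).+1%N
    (fun s' => forall e, (e \in out s') = class_edge d g e).
Proof.
move=> ps.
rewrite (addnS _ 5); apply: (@runs_while _ _ _ _ partial_graph) => // r s'.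
- move=> ps'; have [[h0 h1 h2 h8 hu] h4 hs hc] := ps'.
  rewrite /= h0 h4 => lt; split=> //; pose j := Ordinal lt.
  rewrite (_ : q * 5 + g * (q * 6 + 8) + 5 =
    ((q * 5).+1 + ((g * (q * 6 + 8)).+1 + 1).+1).+1)%N; last by lia.
  apply: runs_do_seq.
    by rewrite /= h4 h2 set_word_lt //; apply: small_lt_word; have := leq_mod r g; lia.
  apply: runs_seq; apply: runs_post; first by apply: (@clique_correct j).
  move=> s1 [[k k4 ks kc] kq].
  apply: runs_do_seq; first by rewrite /= set_word_lt //; apply: small_lt_word; lia.
  apply: runs_seq; apply: runs_post; first by apply: (@classes_correct j).
  move=> s2 [[[l0 l1 l2 l8 lu] l4 ls lc] lq].
  apply: runs_do; first by rewrite /= l4 l1 set_word_lt //=; apply: small_lt_word; lia.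
  split=> //=; first by rewrite addn1.
  move=> [i i'] /= he; rewrite ltnS leq_eqVlt => /orP[/eqP e|]; last by move=> h; exact: lc.
  by have ei : i' = j by [apply: val_inj]; rewrite ei in he *; exact: lq.
move=> [[h0 _ _ _ _] h4 hs hc] /= lt e; apply/idP/idP => [/hs //|he].
apply: hc => //; move: lt; rewrite h0 h4 -leqNgt; exact: leq_trans.
Qed.

End Correctness.

Lemma navigable_cmd_correct (R : realType) (n W : nat) (d : 'I_n -> 'I_n -> R) :
  (forall i, d i i = 0) -> (forall i j, i != j -> 0 < d i j) ->
  (forall j, injective (d^~ j)) -> ((n + 2) ^ 2 <= W)%N ->
  runs W d navigable_cmd (init R n) (42 * n ^ 2 + 3)%N (fun s =>
    (0 < n)%N -> exists g, [/\ (n <= g * g)%N, (g.-1 * g.-1 < n)%N &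
      forall e, (e \in out s) = class_edge d g e]).
Proof.
move=> d_self d_gt0 d_inj W_ge.
have small v : (v <= 1)%N -> (v < W)%N by move=> le; apply: leq_trans W_ge; nia.
pose q g := ((n + g.-1) %/ g)%N.
apply: (@runs_le _ _ _ _ _ _ (1 + ((n * 3).+1 + (39 * n ^ 2).+1))); first by nia.
apply: runs_do_seq; first by rewrite /= set_word_lt // small.
apply: runs_seq; apply: runs_post; first by apply: sqrt_up_correct.
move=> s [g [n_le g_lt [h0 h1 h2 h8 hu] h4 ho]].
(* For [n = 0] the outer loop never starts and the conclusion is vacuous. *)
have [n0|n_gt0] := posnP n.
  exists 1%N, s; split=> //.
  by apply: exec_while_done => /=; rewrite h4 h0; lia.
have g_gt0 : (0 < g)%N by nia.
have {}g_lt : (g.-1 * g.-1 < n)%N by case: g_lt => [g0|//]; rewrite g0 in g_gt0.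
have g_le : (g <= n)%N by nia.
have /andP[q_ge q_le] := ceil_div_bounds n g_gt0; rewrite -/(q g) in q_ge q_le.
(* The cost is quadratic because [q g * g < 2 * n]: all classes together are scanned in [O(n)] steps
   per target. *)
apply: (@runs_le _ _ _ _ _ _ (n * (q g * 5 + g * (q g * 6 + 8) + 6)).+1).
  by rewrite ltnS; nia.
apply: runs_post; first apply: (@targets_correct _ _ _ _ d_self d_gt0 W_ge) => //.
  by split=> //; rewrite ho.
by move=> s' hs' _; exists g; split.
Qed.

(** * The numerical edge bound and the assembly *)

Lemma edge_bound (R : realType) (n g q : nat) :
  (0 < n)%N -> (n <= g * g)%N -> (g.-1 * g.-1 < n)%N ->
  (n <= q * g)%N -> (q * g < n + g)%N ->
  (n * (q.-1 + g.-1))%:R <= 2 * n%:R `^ (3 / 2) - n%:R :> R.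
Proof.
move=> n_gt0 n_le g_lt q_ge q_lt.
have g_gt0 : (0 < g)%N by nia.
have q_gt0 : (0 < q)%N by nia.
(* If [q < g], then [q + g - 1 <= 2 * (g - 1)] and [(g - 1) ^ 2 < n]. Otherwise [n <= g * g] forces
   [q = g], and then [g * g - g < n] gives [(2 * g - 1) ^ 2 <= 4 * n]. *)
have sq : ((q + g).-1 ^ 2 <= 4 * n)%N.
  case: (leqP g q) => h; last by nia.
  have : (q <= g)%N by nia.
  by nia.
rewrite (_ : q.-1 + g.-1 = (q + g).-1 - 1)%N; last by lia.
rewrite mulnBr muln1 natrB; last by rewrite leq_pmulr //; lia.
(* The power is split as [n] times the square root of [n]; then [n] cancels and squares are
   compared. *)
rewrite lerD2r natrM (_ : 3 / 2 = 1 + 2^-1); last first.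
  by rewrite -[3]/(2 + 1)%:R natrD mulrDl divff ?mul1r // pnatr_eq0.
rewrite powRD ?powRr1 ?powR12_sqrt ?ler0n //; last first.
  by rewrite pnatr_eq0 -lt0n n_gt0 implybT.
rewrite mulrCA ler_pM2l ?ltr0n // -(@ler_pXn2r _ 2) ?nnegrE ?mulr_ge0 ?sqrtr_ge0 //.
by rewrite exprMn sqr_sqrtr // -!natrX -natrM ler_nat.
Qed.

Theorem theorem3p6 (R : realType) :
  exists (alg : cmd) (k C : nat),
  forall (P : finType) (n : nat) (p : 'I_n -> P) (d : P -> P -> R),
    #|P| = n -> is_distance d -> general_position p d ->
    exists (t : nat) (s : state R n),
      [/\ exec ((n + 2) ^ k)%N (fun i j => d (p i) (p j)) alg (init R n) t s,
          ((0 < n)%N -> (t <= C * n ^ 2)%N),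
          navigable d (output_graph p s)
        & (#|output_graph p s|)%:R <= 2 * n%:R `^ (3 / 2) - n%:R :> R].
Proof.
(* Exponent 2 leaves room for [g * g] in a word; [45 = 42 + 3] absorbs the additive constant once
   [n > 0]. *)
exists navigable_cmd, 2%N, 45%N => P n p d cardP [_ d0 dC dpos] [p_inj p_gen].
pose d' i j := d (p i) (p j).
have d'0 i : d' i i = 0 by exact: d0.
have d'pos i j : i != j -> 0 < d' i j.
  by move=> /eqP ij; apply: dpos => /p_inj.
have d'inj j : injective (d'^~ j).
  (* General position compares distances from a common first point; symmetry moves that point to the
     second place. *)
  move=> i k; rewrite /d' (dC _ (p j)) (dC (p k)) => e.
  by case: (eqVneq i k) => // /eqP/(p_gen j)/(_ e).
have [t [s [ex le_t spec]]] := navigable_cmd_correct d'0 d'pos d'inj (leqnn _).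
exists t, s.
have [h hp ph] : bijective p by apply: inj_card_bij; rewrite ?card_ord ?cardP.
(* Without points the graph is empty and the bound reads [0 <= 0], as zero to a nonzero power is
   zero. *)
have [n0|n_gt0] := posnP n.
  have P0 (x : P) : False by have := ltn_ord (h x); lia.
  split=> //.
  rewrite (_ : output_graph p s = set0) ?cards0.
    by rewrite n0 powR0 ?mulr0 ?subrr // mulf_eq0 negb_or invr_eq0 !pnatr_eq0.
  by apply/setP => -[x]; have := P0 x.
have [g [n_le g_lt outE]] := spec n_gt0.
have g_gt0 : (0 < g)%N by nia.
pose q := ((n + g.-1) %/ g)%N.
have /andP[q_ge q_le] := ceil_div_bounds n g_gt0; rewrite -/q in q_ge q_le.
split=> // [_|x y xy|].
- by apply: leq_trans le_t _; nia.
- have ne : h x != h y by apply/eqP => /(can_inj ph).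
  have [k [ek lt]] := class_edge_navigable g d'0 d'pos d'inj ne.
  exists (p k); split; last by move: lt; rewrite /d' !ph.
  by apply/imsetP; exists (h x, k); rewrite /= ?ph ?outE.
apply: le_trans (edge_bound R n_gt0 n_le g_lt q_ge _); last by lia.
rewrite ler_nat; apply: leq_trans (leq_imset_card _ _) _.
rewrite (eq_card (B := class_edge d' g)); last by move=> e; rewrite outE.
exact: card_class_edge.
Qed.
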